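(* Consider the problem $\min_{x\in\mathcal H}F(x)=f(x)+\psi(x)$ described in the context, where in addition $f$ is $C^2$ and convex, and set $H(x)=f''(x)$. Suppose there is $L\ge0$ with $$\|f'(y)-f'(x)-H(x)(y-x)\|_*\le L\|x-y\|\qquad\text{for all }x,y\in\mathcal H,$$ and that for some $\mu>0$, $$\frac1{2\mu}\operatorname{dist}(0,\partial F(x))^2\ge F(x)-F^*\qquad\text{for all }x\in\operatorname{dom}F.$$ Let $(x_k)_{k\in\mathbb N}$ be the iterates of the LeAP-SSN algorithm (see context) with arbitrary $x_0\in\operatorname{dom}F$. Then $(x_k)$ has a limit $x^*$, $x^*$ is a global minimum of $F$, and, as $k\to\infty$, $x_k\to x^*$ superlinearly, $F(x_k)-F^*\to0$ superlinearly, and $\|F'(x_k)\|_*\to0$ superlinearly.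
   Context: Setting. $\mathcal H$ is a real Hilbert space with norm $\|\cdot\|$, dual $\mathcal H^*$ with norm $\|\cdot\|_*$, duality pairing $\langle\cdot,\cdot\rangle$, and Riesz map $\mathcal R:\mathcal H\to\mathcal H^*$. $f\in C^{1,1}(\mathcal H;\mathbb R)$ (Fréchet differentiable with Lipschitz derivative $f'$); $\psi:\mathcal H\to\mathbb R\cup\{+\infty\}$ is proper, convex, lower semicontinuous; $F=f+\psi$ is bounded below with minimal value $F^*$ and the solution set $S=\{x:F(x)=F^*\}$ is nonempty. $\operatorname{dom}F=\{F<+\infty\}$; $\partial\psi$ is the convex subdifferential and $\partial F(x)=f'(x)+\partial\psi(x)$; $\operatorname{dist}(0,\partial F(x))=\inf\{\|g\|_*:g\in\partial F(x)\}$ ($+\infty$ if $\partial F(x)=\emptyset$). $H(x):\mathcal H\to\mathcal H^*$ is the symmetric bounded linear operator used in the algorithm. Subproblem. For $x\in\operatorname{dom}F$ and $\lambda>0$ let $\widetilde F(y;x,\lambda)=f(x)+\langle f'(x),y-x\rangle+\frac12\langle H(x)(y-x),y-x\rangle+\frac\lambda2\|y-x\|^2+\psi(y)$, and let $x_+(\lambda,x)$ be its minimiser, which satisfies $-f'(x)-H(x)(x_+-x)-\lambda\mathcal R(x_+-x)\in\partial\psi(x_+)$ (here $\widetilde F(\cdot;x,\lambda)$ is strongly convex, so the minimiser exists and is unique). Set $\psi'(x_+)=-f'(x)-H(x)(x_+-x)-\lambda\mathcal R(x_+-x)$ and $F'(x_+)=f'(x_+)+\psi'(x_+)\in\partial F(x_+)$.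 LeAP-SSN algorithm. Input: $m\ge1$, $\alpha\in(0,1/2]$, $\beta\in(0,(m-1)/(2m)]$, $x_0\in\operatorname{dom}F$, $\psi'(x_0)\in\partial\psi(x_0)$, $\Lambda_0>0$; $F'(x_0)=f'(x_0)+\psi'(x_0)$. At iteration $k=0,1,\dots$: for $j=0,1,\dots$, set $\lambda=2^j\Lambda_k$ and $x_+=x_+(\lambda,x_k)$; if $$\langle F'(x_+),x_k-x_+\rangle\ge\tfrac\alpha\lambda\|F'(x_+)\|_*^2\quad\text{and}\quad F(x_k)-F(x_+)\ge\beta\lambda\|x_+-x_k\|^2,$$ accept: set $j_k=j$, $x_{k+1}=x_+$, $\lambda_k=\lambda=2^{j_k}\Lambda_k$, $\Lambda_{k+1}=\lambda_k/2$, $F'(x_{k+1})=F'(x_+)$ and go to iteration $k+1$; otherwise go to the next $j$. A nonnegative sequence $(a_k)$ converges to $0$ superlinearly if $a_{k+1}\le\varepsilon_ka_k$ for all large $k$ with some $\varepsilon_k\to0$; $x_k\to x^*$ superlinearly means this for $a_k=\|x_k-x^*\|$. *)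

(* Defs.v *)
From HB Require Import structures.
From mathcomp Require Import all_boot all_order all_algebra sesquilinear.
From mathcomp Require Import all_classical all_reals all_analysis.

Set Implicit Arguments.
Unset Strict Implicit.
Unset Printing Implicit Defensive.

Import Order.TTheory GRing.Theory Num.Theory.
Import numFieldNormedType.Exports.

Local Open Scope classical_set_scope.
Local Open Scope ring_scope.

Section bounded_operators.
Context (R : realType) (V W : normedModType R).

Definition is_bounded_operator : {pred V -> W} :=
  fun g => `[< linear g /\ continuous g >].

Record bounded_operator := BoundedOperator {
  bounded_operator_fun :> V -> W ;
  _ : bounded_operator_fun \in is_bounded_operator }.

HB.instance Definition _ := [isSub for bounded_operator_fun].
HB.instance Definition _ := [Choice of bounded_operator by <:].

Lemma is_bounded_operator_submod : submod_closed is_bounded_operator.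
Proof.
split=> [|a g h /asboolP[lg cg] /asboolP[lh ch]]; apply/asboolP; split.
- by move=> a x y /=; rewrite scaler0 addr0.
- exact: cst_continuous.
- move=> b x y; rewrite !fctE/= lg lh !scalerDr -!addrA; congr (_ + _).
    by rewrite !scalerA mulrC.
  by rewrite addrCA.
- move=> x; apply: continuousD; last exact: ch.
  apply: continuous_comp; first exact: cg.
  exact: scaler_continuous.
Qed.

HB.instance Definition _ := GRing.isSubmodClosed.Build R (V -> W)
  is_bounded_operator is_bounded_operator_submod.
HB.instance Definition _ :=
  [SubChoice_isSubLmodule of bounded_operator by <:].

Implicit Types g h : bounded_operator.

Lemma bounded_operator_linear g : linear g.
Proof. by case: g => g gP; have /asboolP[] := gP. Qed.

Lemma bounded_operator_continuous g : continuous g.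
Proof. by case: g => g gP; have /asboolP[] := gP. Qed.

HB.instance Definition _ g :=
  GRing.isLinear.Build R V W *:%R g (bounded_operator_linear g).

Definition operator_norm g : R :=
  sup [set `|g x| | x in [set x : V | `|x| <= 1]].

Lemma operator_norm_has_sup g :
  has_sup [set `|g x| | x in [set x : V | `|x| <= 1]].
Proof.
split; first by exists `|g 0|, 0 => //=; rewrite normr0.
have /linear_boundedP := continuous_linear_bounded 0
  (@bounded_operator_continuous g 0).
move=> /pinfty_ex_gt0[M M0 gM]; exists M => _ [x /= x1 <-].
by rewrite (le_trans (gM x))// ger_pMr.
Qed.

Lemma operator_norm_ub g x : `|x| <= 1 -> `|g x| <= operator_norm g.
Proof.
by move=> x1; apply: ub_le_sup; [case: (operator_norm_has_sup g)|exists x].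
Qed.

Lemma operator_norm_le g M :
  (forall x, `|x| <= 1 -> `|g x| <= M) -> operator_norm g <= M.
Proof.
move=> gM; apply: ge_sup; first by case: (operator_norm_has_sup g).
by move=> _ [x /= x1 <-]; exact: gM.
Qed.

Lemma operator_norm_ge0 g : 0 <= operator_norm g.
Proof. by rewrite (le_trans _ (@operator_norm_ub g 0 _)) ?normr0. Qed.

Lemma le_operator_norm g x : `|g x| <= operator_norm g * `|x|.
Proof.
have [->|x0] := eqVneq x 0; first by rewrite linear0 !normr0 mulr0.
have nx0 : 0 < `|x| by rewrite normr_gt0.
rewrite -ler_pdivrMr// mulrC -[X in X * _](ger0_norm (ltW _)) ?invr_gt0//.
rewrite -normrZ -linearZ; apply: operator_norm_ub.
by rewrite normrZ normfV normr_id mulVf// gt_eqF.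
Qed.

Lemma operator_normD g h :
  operator_norm (g + h) <= operator_norm g + operator_norm h.
Proof.
apply: operator_norm_le => x x1.
by rewrite (le_trans (ler_normD _ _))// lerD// operator_norm_ub.
Qed.

Lemma operator_normZ (a : R) g :
  operator_norm (a *: g) = `|a| * operator_norm g.
Proof.
apply/eqP; rewrite eq_le; apply/andP; split.
  apply: operator_norm_le => x x1.
  by rewrite [leLHS]normrZ ler_wpM2l// operator_norm_ub.
have [->|a0] := eqVneq a 0; first by rewrite normr0 mul0r operator_norm_ge0.
rewrite -ler_pdivlMl ?normr_gt0//; apply: operator_norm_le => x x1.
rewrite ler_pdivlMl ?normr_gt0// -normrZ.
exact: (@operator_norm_ub (a *: g)).
Qed.

Lemma operator_norm0_eq0 g : operator_norm g = 0 -> g = 0.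
Proof.
move=> g0; apply: val_inj; apply/funext => x; apply/eqP.
by rewrite -normr_le0 (le_trans (le_operator_norm g x))// g0 mul0r.
Qed.

HB.instance Definition _ := Lmodule_isNormed.Build R bounded_operator
  operator_normD operator_normZ operator_norm0_eq0.

End bounded_operators.

Definition dual_space (R : realType) (E : normedModType R) :=
  bounded_operator E R.
HB.instance Definition _ (R : realType) (E : normedModType R) :=
  NormedModule.copy (dual_space E) (bounded_operator E R).

HB.mixin Record isHilbert (R : realType) E & NormedModule R E := {
  inner : {dot E for idfun} ;
  inner_norm : forall x : E, inner x x = `|x| ^+ 2 }.

#[short(type="hilbertType")]
HB.structure Definition Hilbert (R : realType) :=
  {E of CompleteNormedModule R E & isHilbert R E}.

Section riesz.
Context (R : realType) (E : hilbertType R).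
Implicit Types x y : E.
Local Notation "<| x , y |>" := (@inner R E x y).

Lemma innerC x y : <|x, y|> = <|y, x|>.
Proof. by have /= := hermC (@inner R E) x y; rewrite expr0 mul1r. Qed.

Lemma cauchy_schwarz x y : `|<|x, y|>| <= `|x| * `|y|.
Proof.
rewrite -(@ler_pXn2r _ 2)// ?nnegrE ?mulr_ge0// exprMn real_normK ?num_real//.
have [->|y0] := eqVneq y 0; first by rewrite linear0r expr0n normr0 expr0n mulr0.
have ny0 : 0 < `|y| ^+ 2 by rewrite exprn_gt0// normr_gt0.
have innerZl a u v : <|a *: u, v|> = a * <|u, v|> by rewrite linearZl_LR.
have innerZr a u v : <|u, a *: v|> = a * <|u, v|> by rewrite innerC innerZl innerC.
pose t := <|x, y|> / `|y| ^+ 2.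
have : 0 <= <|x - t *: y, x - t *: y|> by rewrite inner_norm sqr_ge0.
rewrite linearBl !linearBr /= !innerZl !innerZr (innerC y x) !inner_norm.
rewrite /t divfK ?gt_eqF// subrr subr0 subr_ge0.
by rewrite mulrAC ler_pdivrMr.
Qed.

Lemma is_bounded_operator_inner x :
  (inner x : E -> R) \in @is_bounded_operator R E R.
Proof.
apply/asboolP; split; first by move=> a y z; rewrite linearPr.
pose l : {linear E -> R} := inner x.
apply: (@bounded_linear_continuous _ _ _ l); apply/linear_boundedP.
near=> r => y; rewrite (le_trans (cauchy_schwarz x y))// ler_wpM2r//.
Unshelve. all: by end_near. Qed.

Definition riesz x : dual_space E := BoundedOperator (is_bounded_operator_inner x).

End riesz.

Section convex_analysis.
Context (R : realType) (E : normedModType R).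
Implicit Types (psi : E -> \bar R) (x y : E) (g : dual_space E).
Local Open Scope ereal_scope.

Definition proper_efun psi := (forall x, -oo < psi x) /\ exists x, psi x < +oo.

Definition convex_efun psi := forall x y (t : R), (0 <= t <= 1)%R ->
  psi (t *: x + (1 - t) *: y)%R <= t%:E * psi x + (1 - t)%:E * psi y.

Definition subdifferential psi x : set (dual_space E) :=
  [set g | forall y, psi x + (g (y - x)%R)%:E <= psi y].

(* dist(0, G) in the dual norm. The infimum of the empty set in \bar R is +oo. *)
Definition dist0 (G : set (dual_space E)) : \bar R :=
  ereal_inf [set `|g|%:E | g in G].

Definition is_minimizer (G : E -> \bar R) x := forall y, G x <= G y.

End convex_analysis.

Definition superlinear (R : realType) (a : R^nat) :=
  exists eps : R^nat, eps @ \oo --> (0 : R) /\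
    \forall k \near \oo, a k.+1 <= eps k * a k.

Section leap_ssn.
Context (R : realType) (E : hilbertType R).
Variables (f : E -> R) (df : E -> dual_space E)
  (H : E -> bounded_operator E (dual_space E)) (psi : E -> \bar R).
Local Open Scope ereal_scope.

Definition composite x := (f x)%:E + psi x.

Definition composite_subdifferential x : set (dual_space E) :=
  [set (df x + g)%R | g in subdifferential psi x].

Definition subproblem (x : E) (lam : R) (y : E) :=
  (f x + df x (y - x) + 2^-1 * H x (y - x) (y - x)
   + lam / 2 * `|y - x| ^+ 2)%R%:E + psi y.

Definition psi_grad (x : E) (lam : R) (xp : E) : dual_space E :=
  (- df x - H x (xp - x) - lam *: riesz (xp - x))%R.

Definition F_grad (x : E) (lam : R) (xp : E) : dual_space E :=
  (df xp + psi_grad x lam xp)%R.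

Definition acceptable (alpha beta : R) (x : E) (lam : R) (xp : E) :=
  (F_grad x lam xp (x - xp) >= alpha / lam * `|F_grad x lam xp| ^+ 2)%R /\
  composite x - composite xp >= (beta * lam * `|xp - x| ^+ 2)%:E.

(* x, gF, lam, Lam, j are the sequences x_k, F'(x_k), lambda_k, Lambda_k, j_k
   of a run; j_k is the first index at which the trial step is accepted.
   If composite x0 < +oo then every composite (x k) is finite, by run_accept,
   so that applying fine to objective gaps along a run loses nothing. *)
Record leap_ssn_run (alpha beta : R) (x0 : E) (psi'0 : dual_space E) (Lam0 : R)
    (x : nat -> E) (gF : nat -> dual_space E) (lam Lam : R^nat) (j : nat -> nat)
    : Prop := {
  run_x0 : x 0%N = x0 ;
  run_gF0 : gF 0%N = (df x0 + psi'0)%R ;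
  run_Lam0 : Lam 0%N = Lam0 ;
  run_lam : forall k, lam k = (2 ^+ j k * Lam k)%R ;
  run_x : forall k, is_minimizer (subproblem (x k) (lam k)) (x k.+1) ;
  run_accept : forall k, acceptable alpha beta (x k) (lam k) (x k.+1) ;
  run_reject : forall k i, (i < j k)%N -> forall y,
    is_minimizer (subproblem (x k) (2 ^+ i * Lam k)%R) y ->
    ~ acceptable alpha beta (x k) (2 ^+ i * Lam k)%R y ;
  run_Lam : forall k, Lam k.+1 = (lam k / 2)%R ;
  run_gF : forall k, gF k.+1 = F_grad (x k) (lam k) (x k.+1) }.

End leap_ssn.

(* Main.v *)
Require Import Defs.
From HB Require Import structures.
From mathcomp Require Import all_boot all_order all_algebra sesquilinear.
From mathcomp Require Import all_classical all_reals all_analysis.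
From mathcomp Require Import ring lra.

Set Implicit Arguments.
Unset Strict Implicit.
Unset Printing Implicit Defensive.

Import Order.TTheory GRing.Theory Num.Theory.
Import numFieldNormedType.Exports.

Local Open Scope classical_set_scope.
Local Open Scope ring_scope.

(** Write [d] for the accepted step from [x] to [x+] and
    [r = f'(x+) - f'(x) - f''(x) d] for the linearization residual of the
    gradient. Optimality in the subproblem gives [F'(x+) = r - lam R d], so
    everything is governed by the size of [r] compared with [lam |d|].

    Acceptance. If [|r| <= lam |d| / 2], both acceptance tests hold: the first
    one because [|r - lam R d|^2 <= |r|^2 - 2 lam r(d) + lam^2 |d|^2]
    ([dual_norm_sub_riesz]), the second one because convexity bounds
    [F(x) - F(x+)] below by [F'(x+)(x - x+) = lam |d|^2 - r(d)]
    ([step_descent]). Since [|r| <= L |d|] everywhere, a rejected parameter is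
    less than [2 L], hence the [lam_k] are bounded.

    Rates. Combining the two acceptance tests with convexity and the
    Polyak-Lojasiewicz inequality yields, up to constants,
    [D_{k+1} <= lam_k D_k] for the gap [D_k = F(x_k) - F*],
    [|F'(x_{k+1})|^2 <= lam_k |F'(x_k)|^2] and [|d_{k+1}|^2 <= lam_k |d_k|^2]
    ([gap_le], [gradient_sqr_le], [step_sqr_le]). So it suffices to show that
    the iterates converge and that [lam_k] tends to 0.

    Convergence. The gap decays geometrically because [lam_k] is bounded. When
    [lam_k] is small the bound above makes the steps contract; when it is not,
    the second acceptance test bounds [|d_{k+1}|^2] by a multiple of the gap
    (note [lam_{k+1} >= lam_k / 2]). Either way the steps are dominated by a
    geometric sequence ([steps_geometric]), so [x_k] converges to some [x*],
    which minimizes [F] by lower semicontinuity.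

    Vanishing regularization. Monotonicity of the subdifferential of [psi] and
    convexity of [f] bound a trial step by [lam |d| <= |F'(x_k)|]
    ([trial_step_bound]), and [F'(x_k)] tends to 0 because the steps do. Hence
    trial steps whose parameter is at least a fixed [eps] become arbitrarily
    short and stay near [x*], where continuity of [f''] makes
    [|r| <= eps |d| / 2] ([local_linearization]): they are accepted. So
    eventually [lam_{k+1}] is either [lam_k / 2] or less than [2 eps], which
    forces [lam_k] to 0 ([halving_cvg0]). *)

(** * Differential calculus in normed spaces *)

Section mean_value.
Context (R : realType) (V : normedModType R).

(** The epsilon-delta form of differentiability: the arguments below compare
    several increments of different functions at once, for which explicit radii
    are easier to handle than Landau symbols. *)
Lemma is_diff_littleo (W : normedModType R) (G A : V -> W) (x : V) :
  is_diff x G A -> forall e, 0 < e ->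
  exists2 d, 0 < d & forall h, `|h| < d -> `|G (h + x) - G x - A h| <= e * `|h|.
Proof.
move=> GA e e0; have [_ ] := (diff_locallyP x G).1 (@ex_diff _ _ _ _ _ _ _ GA).
rewrite (@diff_val _ _ _ _ _ _ _ GA) => /eqaddoP/(_ _ e0).
move=> /nbhs_norm0P[d d0 dP]; exists d => // h hd.
by have := dP h hd; rewrite /= opprD addrA.
Qed.

Lemma is_derive_line (G : V -> R) (A : V -> R) (x v : V) (t : R) :
  is_diff (t *: v + x) G A -> is_derive t 1 (fun s => G (s *: v + x)) (A v).
Proof.
move=> GA.
have L : is_diff t (fun s : R => s *: v + x) (fun s => s *: v).
  have /is_diff_eq := is_diffD (is_diff_scalel t v) (is_diff_cst x t).
  by apply; rewrite addr0.
have GL := @is_diff_comp R R V R _ _ G A t L GA.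
have dGL := @ex_diff _ _ _ _ _ _ _ GL.
apply: DeriveDef; first exact: diff_derivable dGL.
by rewrite deriveE// (@diff_val _ _ _ _ _ _ _ GL) /= scale1r.
Qed.

(** The one-dimensional mean value theorem along the segment from [x] to [y]. *)
Lemma mean_value (G : V -> R) (A : V -> V -> R) (x y : V) :
  (forall z, is_diff z G (A z)) ->
  exists2 c : R, 0 <= c <= 1 & G y - G x = A (c *: (y - x) + x) (y - x).
Proof.
move=> GA.
have D (t : R) : is_derive t (1 : R) (fun s => G (s *: (y - x) + x)) (A (t *: (y - x) + x) (y - x)).
  exact: is_derive_line.
have [|c c01] := @MVT_segment R _ _ 0 1 ler01 (fun t _ => D t).
  apply: continuous_subspaceT => t.
  apply: differentiable_continuous; apply/derivable1_diffP.
  exact: (@ex_derive _ _ _ _ _ _ _ (D t)).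
rewrite subr0 mulr1 scale1r scale0r add0r subrK => ->.
by exists c.
Qed.
End mean_value.

Section bounded.
Context (R : realType) (V W : normedModType R).
Implicit Type g : bounded_operator V W.

Lemma bounded_operator_le g (z : V) : `|g z| <= `|g| * `|z|.
Proof. exact: le_operator_norm. Qed.

Lemma bounded_operator_norm_le g (M : R) :
  0 <= M -> (forall z, `|g z| <= M * `|z|) -> `|g| <= M.
Proof.
move=> M0 gM; apply: operator_norm_le => z z1.
by rewrite (le_trans (gM z))// ler_piMr.
Qed.

Lemma is_diff_bounded_operator g z : is_diff z g g.
Proof.
have gc := @bounded_operator_continuous _ _ _ g.
apply: DiffDef; first exact: linear_differentiable.
exact: diff_lin.
Qed.

(** Evaluation at a point, as a bounded linear map on operators: it reduces
    derivatives of dual-valued maps to derivatives of real-valued ones. *)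
Definition evaluation (z : V) : bounded_operator V W -> W := fun g => g z.

Lemma evaluation_linear z : linear (@evaluation z).
Proof. by []. Qed.

HB.instance Definition _ z := GRing.isLinear.Build R (bounded_operator V W) W *:%R
  (evaluation z) (@evaluation_linear z).

Lemma evaluation_continuous z : continuous (@evaluation z).
Proof.
apply: bounded_linear_continuous; apply/linear_boundedP.
near=> r => g; rewrite (le_trans (bounded_operator_le g z))// mulrC ler_wpM2r//.
Unshelve. all: by end_near. Qed.

Lemma is_diff_evaluation z g : is_diff g (@evaluation z) (@evaluation z).
Proof.
have c := @evaluation_continuous z.
apply: DiffDef; first exact: linear_differentiable.
exact: diff_lin.
Qed.

End bounded.

(* The algebraic rules for dual elements, and for operators with values in the
   dual, are stated at these very types so that they can serve as rewriting
   rules. *)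
Section dual.
Context (R : realType) (E : normedModType R).
Implicit Type g : dual_space E.

Lemma dual_le g z : `|g z| <= `|g| * `|z|.
Proof. exact: le_operator_norm. Qed.

Lemma dual_norm_le g (M : R) :
  0 <= M -> (forall z, `|g z| <= M * `|z|) -> `|g| <= M.
Proof. exact: bounded_operator_norm_le. Qed.

Lemma dualDl g h z : (g + h) z = g z + h z. Proof. by []. Qed.
Lemma dualNl g z : (- g) z = - g z. Proof. by []. Qed.
Lemma dualBl g h z : (g - h) z = g z - h z. Proof. by []. Qed.
Lemma dualZl (a : R) g z : (a *: g) z = a * g z. Proof. by []. Qed.
Lemma dualDr g y z : g (y + z) = g y + g z. Proof. exact: linearD. Qed.
Lemma dualNr g z : g (- z) = - g z. Proof. exact: linearN. Qed.
Lemma dualZr (a : R) g z : g (a *: z) = a * g z. Proof. exact: linearZ. Qed.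

Lemma dual0r g : g 0 = 0. Proof. exact: linear0. Qed.

Definition dualE := (dualDl, dualNl, dualZl, dualDr, dualNr, dualZr).

Implicit Type B : bounded_operator E (dual_space E).
Lemma operatorDl B C z : (B + C) z = B z + C z. Proof. by []. Qed.
Lemma operatorNl B z : (- B) z = - B z. Proof. by []. Qed.
Lemma operatorDr B y z : B (y + z) = B y + B z. Proof. exact: linearD. Qed.
Lemma operatorNr B z : B (- z) = - B z. Proof. exact: linearN. Qed.
Lemma operatorZr (a : R) B z : B (a *: z) = a *: B z. Proof. exact: linearZ. Qed.
Definition operatorE := (operatorDl, operatorNl, operatorDr, operatorNr, operatorZr, dualE).

End dual.

Section convex_smooth.
Context (R : realType) (E : normedModType R).

Lemma small_scaling (w : E) (d : R) : 0 < d ->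
  exists2 t : R, 0 < t <= 1 & `|t *: w| < d.
Proof.
move=> d0; have s0 : 0 < d + `|w| by rewrite ltr_wpDr.
exists (d / (d + `|w|)).
  by rewrite divr_gt0//= ler_pdivrMr// mul1r lerDl.
rewrite normrZ ger0_norm ?divr_ge0 ?ltW// mulrAC ltr_pdivrMr//.
by rewrite ltr_pM2l// ltrDr.
Qed.

Lemma convex_functionE (f : E -> R) : convex_function [set: convex_lmodType E] f ->
  forall x y (t : R), 0 <= t <= 1 ->
  f (t *: x + (1 - t) *: y) <= t * f x + (1 - t) * f y.
Proof.
move=> cf x y t t01.
have := cf (Itv01 (andP t01).1 (andP t01).2) x y.
by rewrite !inE; apply.
Qed.

(** Comparing [f] with its chord on [x, x + t (y - x)] and dividing by [t]
    gives the inequality up to any positive error as [t] tends to 0. *)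
Lemma convex_first_order (f : E -> R) (A : dual_space E) x :
  convex_function [set: convex_lmodType E] f -> is_diff x f A ->
  forall y, f x + A (y - x) <= f y.
Proof.
move=> /convex_functionE cf fA y; apply/ler_addgt0Pr => e e0.
set w := y - x.
have e'0 : 0 < e / (`|w| + 1) by rewrite divr_gt0// ltr_wpDl.
have [d d0 dP] := is_diff_littleo fA e'0.
have [t /andP[t0 t1] tw] := small_scaling w d0.
have := dP _ tw; rewrite linearZ /= normrZ (gtr0_norm t0) => /ler_normlP[+ _].
have := cf y x t; rewrite (ltW t0) t1 => /(_ isT).
have -> : t *: y + (1 - t) *: x = t *: w + x.
  by rewrite /w scalerBr scalerBl scale1r addrA addrAC.
move=> H1 H2.
have H3 : e / (`|w| + 1) * `|w| <= e.
  by rewrite mulrAC ler_pdivrMr ?ltr_wpDl// ler_wpM2l ?lerDl// ltW.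
rewrite -(ler_pM2l t0).
have : t * (e / (`|w| + 1) * `|w|) <= t * e by rewrite ler_pM2l.
move: H1 H2; rewrite -/w -[t *: A w]/(t * A w); nra.
Qed.
End convex_smooth.

(** * The Hessian of a convex function *)

Section hessian.
Context (R : realType) (E : normedModType R).
Variables (f : E -> R) (df : E -> dual_space E).
Hypothesis f_diff : forall x, is_diff x f (df x).

(** The second difference of [f] along [p] and [q] is an increment along [p] of
    [s |-> f (q + s) - f s], whose gradient is close to [B q] near [x]. *)
Lemma second_difference (x : E) (B : bounded_operator E (dual_space E)) (e : R) :
  is_diff x df B -> 0 < e ->
  exists2 d, 0 < d & forall p q, `|p| + `|q| < d ->
    `|f (p + (q + x)) - f (q + x) - (f (p + x) - f x) - B q p|
      <= e * (`|p| + `|q|) * `|p|.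
Proof.
move=> dfB e0; have e20 : 0 < e / 2 by rewrite divr_gt0.
have [d d0 dP] := is_diff_littleo dfB e20.
exists d => // p q pqd.
pose G s := f (q + s) - f s; pose A s := df (q + s) - df s.
have GA s : is_diff s G (A s).
  have S : is_diff s (fun s => q + s) id.
    have /is_diff_eq := is_diffD (is_diff_cst q s) (is_diff_id s).
    by apply; rewrite add0r.
  have /is_diff_eq := is_diffB (is_diff_comp S (f_diff (q + s))) (f_diff s).
  by apply.
have [c /andP[c0 c1]] := mean_value x (p + x) GA.
rewrite addrK /G [q + (p + x)]addrCA => D.
have -> : f (p + (q + x)) - f (q + x) - (f (p + x) - f x)
    = A (c *: p + x) p by rewrite -D; ring.
have cp : `|c *: p| <= `|p| by rewrite normrZ ger0_norm// ler_piMl.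
have h1 : `|q + c *: p| < d.
  by rewrite (le_lt_trans (ler_normD _ _))// (le_lt_trans _ pqd)// addrC lerD2r.
have h2 : `|c *: p| < d.
  by rewrite (le_lt_trans cp)// (le_lt_trans _ pqd)// lerDl.
have := dP _ h1; have := dP _ h2; rewrite -[q + _ + x]addrA.
set a1 := df _ - df x - _; set a2 := df _ - df x - _ => a1P a2P.
have -> : A (c *: p + x) p - B q p = (a2 - a1) p.
  rewrite /A /a1 /a2 !operatorE; ring.
rewrite (le_trans (dual_le _ _))// ler_wpM2r//.
rewrite (le_trans (ler_normB _ _))// (le_trans (lerD a2P a1P))//.
rewrite -mulrDr.
have : `|q + c *: p| <= `|p| + `|q|.
  by rewrite (le_trans (ler_normD _ _))// addrC lerD2r.
have : `|c *: p| <= `|p| + `|q| by rewrite (le_trans cp)// lerDl.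
nra.
Qed.

(** Schwarz's theorem: the second difference is symmetric in the two
    directions, and both [B v u] and [B u v] approximate it to second order. *)
Lemma hessian_symmetric (x : E) (B : bounded_operator E (dual_space E)) u v :
  is_diff x df B -> B u v = B v u.
Proof.
move=> dfB; apply/eqP; rewrite -subr_eq0 -normr_le0; apply/ler_addgt0Pr => e e0.
rewrite add0r; set s := `|u| + `|v|.
have s0 : 0 <= s by rewrite addr_ge0.
have s10 : 0 < s ^+ 2 + 1 by rewrite ltr_wpDl// sqr_ge0.
have e'0 : 0 < e / (s ^+ 2 + 1) by rewrite divr_gt0.
have [d d0 dP] := second_difference dfB e'0.
have [t t0 ts] : exists2 t, 0 < t & t * s < d.
  exists (d / (d + s)); first by rewrite divr_gt0// ltr_wpDr.
  by rewrite mulrAC ltr_pdivrMr ?ltr_wpDr// ltr_pM2l// ltrDr.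
have td : `|t *: u| + `|t *: v| < d.
  by rewrite !normrZ -mulrDr (gtr0_norm t0).
have := dP _ _ td; rewrite addrC in td; have := dP _ _ td.
rewrite [t *: v + (t *: u + x)]addrCA.
set D1 := f _; set D2 := f _; set D3 := f _; set D4 := f _.
rewrite [`|t *: v| + _]addrC !normrZ (gtr0_norm t0) -mulrDr -/s !operatorE.
move=> /ler_normlP[H1 H2] /ler_normlP[H3 H4].
have K : e / (s ^+ 2 + 1) * s ^+ 2 <= e.
  by rewrite mulrAC ler_pdivrMr// ler_wpM2l ?lerDl// ltW.
have K2 : t ^+ 2 * `|B u v - B v u| <= t ^+ 2 * e.
  apply: le_trans (ler_wpM2l (sqr_ge0 t) K).
  have -> : t ^+ 2 * (e / (s ^+ 2 + 1) * s ^+ 2) =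
     e / (s ^+ 2 + 1) * (t * s) * (t * `|v|) + e / (s ^+ 2 + 1) * (t * s) * (t * `|u|).
    by rewrite -!mulrDr [_ + `|u|]addrC -/s; ring.
  rewrite -[X in X * `|_|]ger0_norm ?sqr_ge0// -normrM.
  by apply/ler_normlP; split; lra.
by rewrite ler_pM2l ?exprn_gt0// in K2.
Qed.

Hypothesis f_convex : convex_function [set: convex_lmodType E] f.

Lemma gradient_monotone x y : 0 <= (df y - df x) (y - x).
Proof.
have := convex_first_order f_convex (f_diff x) y.
have := convex_first_order f_convex (f_diff y) x.
have -> : df y (x - y) = - df y (y - x) by rewrite -dualNr opprB.
by rewrite !dualE; lra.
Qed.

(** The difference quotients of a monotone gradient are nonnegative along the
    increment. *)
Lemma hessian_psd (x : E) (B : bounded_operator E (dual_space E)) u :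
  is_diff x df B -> 0 <= B u u.
Proof.
move=> dfB; apply/ler_addgt0Pr => e e0.
have s10 : 0 < `|u| ^+ 2 + 1 by rewrite ltr_wpDl// sqr_ge0.
have e'0 : 0 < e / (`|u| ^+ 2 + 1) by rewrite divr_gt0.
have [d d0 dP] := is_diff_littleo dfB e'0.
have [t /andP[t0 t1] tu] := small_scaling u d0.
have := gradient_monotone x (t *: u + x); rewrite addrK => m0.
have := le_trans (dual_le _ (t *: u)) (ler_wpM2r (normr_ge0 (t *: u)) (dP _ tu)).
move=> /ler_normlP[_]; rewrite [X in X <= _]dualBl.
have -> : B (t *: u) (t *: u) = t ^+ 2 * B u u.
  rewrite !operatorE mulrA -expr2; congr (_ * _).
rewrite normrZ (gtr0_norm t0) => m1.
have K : e / (`|u| ^+ 2 + 1) * `|u| ^+ 2 <= e.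
  by rewrite mulrAC ler_pdivrMr// ler_wpM2l ?lerDl// ltW.
have K2 : t ^+ 2 * (e / (`|u| ^+ 2 + 1) * `|u| ^+ 2) <= t ^+ 2 * e.
  by rewrite ler_wpM2l ?sqr_ge0.
rewrite -(ler_pM2l (exprn_gt0 2 t0)) mulr0 mulrDr.
apply: le_trans m0 _.
rewrite -lerBlDl (le_trans m1)// (le_trans _ K2)//.
by rewrite le_eqVlt; apply/orP; left; apply/eqP; ring.
Qed.

End hessian.

Section linearization.
Context (R : realType) (E : normedModType R).

(** Continuity of [H] at [a] makes the linearization of [G] uniformly accurate
    for pairs of points near [a], by the mean value theorem applied to
    [z |-> G z v - H x z v] for each direction [v]. *)
Lemma local_linearization (G : E -> dual_space E)
    (H : E -> bounded_operator E (dual_space E)) (a : E) (e : R) :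
  (forall x, is_diff x G (H x)) -> {for a, continuous H} -> 0 < e ->
  exists2 d, 0 < d & forall x y, `|x - a| < d -> `|y - a| < d ->
    `|G y - G x - H x (y - x)| <= e * `|y - x|.
Proof.
move=> GH Hc e0; have e20 : 0 < e / 2 by rewrite divr_gt0.
move/cvgr_dist_le: (Hc) => /(_ _ e20) /nbhs_normP[d /= d0 dP].
exists d => // x y xa ya.
apply: dual_norm_le => [|v]; first by rewrite mulr_ge0// ltW.
pose K z := G z v - H x z v; pose A z h := H z h v - H x h v.
have KA z : is_diff z K (A z).
  have D1 := is_diff_comp (GH z) (is_diff_evaluation v (G z)).
  have D2 := is_diff_comp (is_diff_bounded_operator (H x) z)
    (is_diff_evaluation v (H x z)).
  by have /is_diff_eq := is_diffB D1 D2; apply.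
have [c /andP[c0 c1]] := mean_value x y KA.
set w := c *: _ + _; rewrite /K /A => D.
have -> : (G y - G x - H x (y - x)) v = (H w - H x) (y - x) v.
  rewrite !dualE -D.
  by rewrite !operatorE; ring.
rewrite (le_trans (dual_le _ _))// ler_wpM2r//.
rewrite (le_trans (bounded_operator_le _ _))// ler_wpM2r//.
have Hx : `|H a - H x| <= e / 2 by apply: dP; rewrite /= distrC.
have Hw : `|H a - H w| <= e / 2.
  apply: dP; rewrite /= distrC.
  have -> : w - a = c *: (y - a) + (1 - c) *: (x - a).
    have -> : y - a = (y - x) + (x - a) by rewrite addrA subrK.
    by rewrite [in RHS]scalerDr -[RHS]addrA -scalerDl [c + _]addrC subrK scale1r addrA.
  rewrite (le_lt_trans (ler_normD _ _))// !normrZ (ger0_norm c0) ger0_norm ?subr_ge0//.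
  move: c1; rewrite le_eqVlt => /orP[/eqP ->|c1]; first by rewrite subrr mul0r addr0 mul1r.
  have : (1 - c) * `|x - a| < (1 - c) * d by rewrite ltr_pM2l// subr_gt0.
  have : c * `|y - a| <= c * d by rewrite ler_wpM2l// ltW.
  by lra.
have -> : H w - H x = (H a - H x) - (H a - H w) by rewrite opprB [RHS]addrC addrA subrK.
by rewrite (le_trans (ler_normB _ _))// (le_trans (lerD Hx Hw))// -splitr.
Qed.
End linearization.

(** * Existence of minimizers *)

Section extended_functions.
Context (R : realType) (E : normedModType R).
Implicit Types (psi : E -> \bar R).

Lemma proper_efun_fin psi x : proper_efun psi -> (psi x < +oo)%E ->
  exists r : R, psi x = r%:E.
Proof.
move=> [/(_ x) + _]; case: (psi x) => [r _ _|//|//]; by exists r.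
Qed.

Lemma convex_efun_fin psi x y (a b t : R) : proper_efun psi -> convex_efun psi ->
  psi x = a%:E -> psi y = b%:E -> 0 <= t <= 1 ->
  exists2 r : R, psi (t *: x + (1 - t) *: y) = r%:E & r <= t * a + (1 - t) * b.
Proof.
move=> pr cv xa yb t01; have := cv x y t t01; rewrite xa yb -!EFinM -EFinD => h.
have [r rE] := proper_efun_fin pr (le_lt_trans h (ltry _)).
by exists r => //; rewrite -lee_fin -rE.
Qed.

End extended_functions.

(** Cauchy's criterion with the index [N] itself as the reference point, which
    is the form that tail estimates produce. *)
Lemma sequence_cauchy_cvg (R : realType) (V : completeNormedModType R) (u : nat -> V) :
  (forall e, 0 < e -> exists N, forall n, (N <= n)%N -> `|u N - u n| < e) ->
  exists l : V, u @ \oo --> l.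
Proof.
move=> uC; suff : cvg (u @ \oo) by move=> ?; exists (lim (u @ \oo)).
suff : cauchy (u @ \oo) by exact: cauchy_cvg.
suff : cauchy_ex (u @ \oo) by exact: cauchy_exP.
move=> e e0.
have [N NP] := uC _ e0; exists (u N); exists N => // n /= Nn.
by rewrite -ball_normE; exact: NP.
Qed.

Section lower_semicontinuous_limit.
Context (R : realType) (V : normedModType R).
Local Open Scope ereal_scope.

(** Used twice: for minimizing sequences of a subproblem and for the limit of
    the iterates. *)
Lemma lower_semicontinuous_add_limit (Q : V -> R) (psi : V -> \bar R)
    (y : nat -> V) (l : V) (v : nat -> R) (b : R) :
  {for l, continuous Q} -> proper_efun psi -> lower_semicontinuous psi ->
  y @ \oo --> l -> v @ \oo --> b ->
  (forall n, (Q (y n))%:E + psi (y n) <= (v n)%:E) ->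
  (Q l)%:E + psi l <= b%:E.
Proof.
move=> Qc pr lsc yl vb Qv; rewrite leNgt; apply/negP => bl.
have [a ba al] : exists2 a : R, (b < Q l + a)%R & a%:E < psi l.
  have := pr.1 l; move: bl; case: (psi l) => [s| |]//=.
    rewrite -EFinD lte_fin => h _; exists ((b - Q l + s) / 2)%R; first by lra.
    by rewrite lte_fin; lra.
  by move=> _ _; exists (b - Q l + 1)%R; rewrite ?ltry//; lra.
have [U Ul Ua] := lsc l a al.
suff : (Q l + a <= b)%R by rewrite leNgt ba.
have Qyl : (Q \o y) @ \oo --> Q l by apply: continuous_cvg.
have Qya : (Q (y n) + a)%R @[n --> \oo] --> (Q l + a)%R.
  by apply: cvgD => //; exact: cvg_cst.
apply: (ler_cvg_to Qya vb).
near=> n; have /Ua : U (y n) by near: n; exact: yl.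
have := Qv n; case: (psi (y n)) => [r| |]//=.
by rewrite -EFinD lee_fin lte_fin; lra.
Unshelve. all: by end_near. Qed.

End lower_semicontinuous_limit.

Section minimizer_existence.
Context (R : realType) (V : completeNormedModType R).
Local Open Scope ereal_scope.

(** The direct method: by the midpoint inequality a minimizing sequence is
    Cauchy, so completeness replaces weak compactness. *)
Lemma strongly_convex_minimizer (Q : V -> R) (psi : V -> \bar R) (c b : R) :
  (0 < c)%R -> continuous Q ->
  proper_efun psi -> convex_efun psi -> lower_semicontinuous psi ->
  (forall y z, Q (2^-1 *: y + (1 - 2^-1) *: z) <=
    2^-1 * Q y + (1 - 2^-1) * Q z - c * `|y - z| ^+ 2)%R ->
  (forall y, b%:E <= (Q y)%:E + psi y) ->
  exists y, is_minimizer (fun y => (Q y)%:E + psi y) y.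
Proof.
move=> c0 Qc pr cv lsc Qm Qb.
pose A := [set r : R | exists y, (Q y)%:E + psi y = r%:E].
have A0 : A !=set0.
  have [_ [p /(proper_efun_fin pr)[r rE]]] := pr.
  by exists (Q p + r)%R, p; rewrite rE.
have Ab : has_lbound A.
  by exists b => r [y yE]; rewrite -lee_fin -yE.
have Ai : has_inf A by split.
have inf_le y : (inf A)%:E <= (Q y)%:E + psi y.
  have := pr.1 y; case E : (psi y) => [r| |]// _; last by rewrite addey// leey.
  by rewrite -EFinD lee_fin; apply: ge_inf => //; exists y; rewrite E.
have yP n : exists y, exists2 r : R, psi y = r%:E & (Q y + r < inf A + n.+1%:R^-1)%R.
  have n0 : (0 < n.+1%:R^-1 :> R)%R by rewrite invr_gt0.
  have [s [y yE] yl] := inf_adherent n0 Ai.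
  exists y; have := yE; case E : (psi y) => [r| |]// [yr].
  by exists r => //; rewrite yr.
have {yP}[y yP] := choice yP.
have dist n k : (n <= k)%N -> (c * `|y n - y k| ^+ 2 <= n.+1%:R^-1)%R.
  move=> nk; have [r rE rl] := yP n; have [s sE sl] := yP k.
  have h01 : (0 <= (2^-1 : R) <= 1)%R by apply/andP; split; lra.
  have [q qE ql] := convex_efun_fin pr cv rE sE h01.
  have := inf_le (2^-1 *: y n + (1 - 2^-1) *: y k)%R.
  rewrite qE -EFinD lee_fin => h.
  have := Qm (y n) (y k).
  have : (k.+1%:R^-1 <= n.+1%:R^-1 :> R)%R by rewrite lef_pV2 ?posrE// ler_nat.
  move: rl sl ql h; set p := k.+1%:R^-1%R; set p1 := n.+1%:R^-1%R.
  set N := (`|_| ^+ 2)%R; set X := Q (_ + _)%R.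
  by lra.
have [l yl] : exists l : V, y @ \oo --> l.
  apply: sequence_cauchy_cvg => e e0.
  have ce0 : (0 < c * e ^+ 2)%R by rewrite mulr_gt0// exprn_gt0.
  have := @near_infty_natSinv_lt R (PosNum ce0) => -[N _ NP].
  exists N => n Nn; rewrite -(@ltr_pXn2r _ 2)// ?nnegrE// ?ltW//.
  rewrite -(ltr_pM2l c0) (le_lt_trans (dist _ _ Nn))//.
  exact: NP (leqnn N).
exists l => z; apply: le_trans (inf_le z).
apply: (@lower_semicontinuous_add_limit _ _ _ _ y l (fun n => inf A + n.+1%:R^-1)%R) => //.
- exact: Qc.
- rewrite -[X in _ --> X]addr0; apply: cvgD; first exact: cvg_cst.
  exact: cvg_harmonic.
- move=> n; have [r -> rl] := yP n; rewrite -EFinD lee_fin; exact: ltW.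
Qed.

End minimizer_existence.

(** * The dual norm of a Hilbert space *)

Section hilbert.
Context (R : realType) (E : hilbertType R).
Implicit Types (d x y z : E) (r : dual_space E).

Lemma rieszC x y : riesz x y = riesz y x.
Proof. exact: innerC. Qed.

Lemma riesz_norm x : riesz x x = `|x| ^+ 2.
Proof. exact: inner_norm. Qed.

Lemma sqr_normD x y : `|x + y| ^+ 2 = `|x| ^+ 2 + 2 * riesz x y + `|y| ^+ 2.
Proof.
rewrite -!riesz_norm dualDr (rieszC _ x) (rieszC _ y) !dualDr (rieszC y x).
by ring.
Qed.

(** The squared dual norm is the Fenchel conjugate [sup_z (2 r(z) - |z|^2)];
    the bound at [z] rescaled by [r(z) / |z|^2] is the one that is needed. *)
Lemma dual_norm_sqr_le r (K : R) :
  (forall z, 2 * r z - `|z| ^+ 2 <= K) -> `|r| ^+ 2 <= K.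
Proof.
move=> rK; have K0 : 0 <= K.
  by have := rK 0; rewrite dual0r normr0; lra.
rewrite -[leRHS]sqr_sqrtr// ler_pXn2r ?nnegrE ?sqrtr_ge0//.
apply: dual_norm_le; first exact: sqrtr_ge0.
move=> z; rewrite -(@ler_pXn2r _ 2)// ?nnegrE ?mulr_ge0// ?sqrtr_ge0//.
rewrite exprMn sqr_sqrtr// real_normK ?num_real//.
have [->|z0] := eqVneq z 0.
  by rewrite dual0r normr0 !expr0n/= mulr0.
have nz0 : 0 < `|z| ^+ 2 by rewrite exprn_gt0// normr_gt0.
have := rK ((r z / `|z| ^+ 2) *: z).
rewrite dualZr normrZ exprMn real_normK ?num_real//.
set a := r z; set b := `|z| ^+ 2 => h.
have b0 : b != 0 by rewrite /b gt_eqF.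
have -> : a ^+ 2 = (2 * (a / b * a) - (a / b) ^+ 2 * b) * b by field.
by rewrite ler_pM2r.
Qed.

(** In the dual Hilbert space this is the expansion of the square. Substituting
    [w = z + lam d] in the conjugate formula proves it without representing [r]
    by a vector. *)
Lemma dual_norm_sub_riesz r d (lam : R) :
  `|r - lam *: riesz d| ^+ 2 <= `|r| ^+ 2 - 2 * lam * r d + lam ^+ 2 * `|d| ^+ 2.
Proof.
apply: dual_norm_sqr_le => z; rewrite !dualE.
have h1 : r (z + lam *: d) <= `|r| * `|z + lam *: d|.
  by have /ler_normlP[] := dual_le r (z + lam *: d).
have := sqr_normD z (lam *: d).
move: h1; rewrite !dualE => h1 h2.
have h3 : `|lam *: d| ^+ 2 = lam ^+ 2 * `|d| ^+ 2.
  by rewrite normrZ exprMn real_normK ?num_real.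
have -> : riesz d z = riesz z d by rewrite rieszC.
have := sqr_ge0 (`|r| - `|z + lam *: d|).
nra.
Qed.

End hilbert.

(** * The regularized Newton subproblem *)

Section regularized_model.
Context (R : realType) (E : hilbertType R).
Variables (c : R) (g : dual_space E) (B : bounded_operator E (dual_space E)) (lam : R).
Hypothesis B_sym : forall u v, B u v = B v u.

Definition model (w : E) : R :=
  c + g w + 2^-1 * B w w + lam / 2 * `|w| ^+ 2.

Lemma model_add w h : model (w + h) =
  model w + (g h + B w h + lam * riesz w h) + (2^-1 * B h h + lam / 2 * `|h| ^+ 2).
Proof.
by rewrite /model sqr_normD !operatorE (B_sym h w); field.
Qed.

(* Only the quadratic term needs work; it is continuous because
   [B z z - B w w = B (z - w) z + B w (z - w)]. *)
Lemma model_continuous : continuous model.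
Proof.
move=> w; rewrite /model.
have gC : g z @[z --> w] --> g w by exact: bounded_operator_continuous.
have nC : `|z| @[z --> w] --> `|w| by exact: norm_continuous.
have BC : B z z @[z --> w] --> B w w.
  apply/subr_cvg0/norm_cvg0P.
  apply: (@squeeze_cvgr _ _ _ _ (cst 0)
    (fun z => `|z - w| * (`|B| * (`|z| + `|w|)))).
  - near=> z; rewrite normr_ge0/=.
    have -> : B z z - B w w = B (z - w) z + B w (z - w) by rewrite !operatorE; ring.
    rewrite (le_trans (ler_normD _ _))// !mulrDr lerD//.
      rewrite (le_trans (dual_le _ _))// mulrA ler_wpM2r//.
      by rewrite mulrC bounded_operator_le.
    rewrite (le_trans (dual_le _ _))// mulrC ler_wpM2l//.
    exact: bounded_operator_le.
  - exact: cvg_cst.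
  - rewrite -[X in _ --> X](mul0r (`|B| * (`|w| + `|w|))).
    apply: cvgM; last first.
      by apply: cvgM; [exact: cvg_cst|apply: cvgD => //; exact: cvg_cst].
    have /cvg_norm : z - w @[z --> w] --> (0 : E) by apply/subr_cvg0; exact: cvg_id.
    by rewrite normr0.
apply: cvgD; last first.
  apply: cvgM; first exact: cvg_cst.
  by rewrite expr2; under eq_fun do rewrite expr2; exact: cvgM.
apply: cvgD; last by apply: cvgM => //; exact: cvg_cst.
by apply: cvgD => //; exact: cvg_cst.
Unshelve. all: by end_near. Qed.

Hypothesis B_psd : forall u, 0 <= B u u.

Lemma model_midpoint y z :
  model (2^-1 *: y + (1 - 2^-1) *: z) <=
    2^-1 * model y + (1 - 2^-1) * model z - lam / 8 * `|y - z| ^+ 2.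
Proof.
have -> : 2^-1 *: y + (1 - 2^-1) *: z = z + 2^-1 *: (y - z).
  by rewrite scalerBl scale1r scalerBr addrCA.
have -> : model y = model (z + (y - z)) by rewrite addrC subrK.
move: (y - z) => h; rewrite !model_add !operatorE normrZ exprMn real_normK ?num_real//.
have := B_psd h; lra.
Qed.

End regularized_model.

Section subproblem_theory.
Context (R : realType) (E : hilbertType R).
Variables (f : E -> R) (df : E -> dual_space E)
  (H : E -> bounded_operator E (dual_space E)) (psi : E -> \bar R).
Hypothesis H_sym : forall x u v, H x u v = H x v u.
Hypothesis H_psd : forall x u, 0 <= H x u u.
Hypothesis f_first_order : forall x y, f x + df x (y - x) <= f y.
Hypothesis psi_proper : proper_efun psi.
Hypothesis psi_convex : convex_efun psi.
Hypothesis psi_lsc : lower_semicontinuous psi.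

Lemma subproblemE x lam y :
  subproblem f df H psi x lam y = ((model (f x) (df x) (H x) lam (y - x))%:E + psi y)%E.
Proof. by []. Qed.

Lemma psi_gradE x lam y h :
  psi_grad df H x lam y h = - df x h - H x (y - x) h - lam * riesz (y - x) h.
Proof. by []. Qed.

Lemma F_gradE x lam y : F_grad df H x lam y =
  (df y - df x - H x (y - x)) - lam *: riesz (y - x).
Proof. by rewrite /F_grad /psi_grad !addrA. Qed.

Lemma subproblem_minimizer_fin x lam y :
  is_minimizer (subproblem f df H psi x lam) y -> exists r : R, psi y = r%:E.
Proof.
have [_ [p /(proper_efun_fin psi_proper)[s sE]]] := psi_proper.
move=> /(_ p); rewrite !subproblemE sE => h.
apply: proper_efun_fin => //; rewrite ltey; apply/eqP => yE.
by move: h; rewrite yE addey.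
Qed.

(** First-order optimality: moving from [y] towards [z] by a fraction [t]
    changes the smooth part by [t l + t^2 C] and [psi] by at most
    [t (psi z - psi y)]; divide by [t] and let it tend to 0. Symmetry of
    [H x] is what identifies the derivative [l] with [- psi_grad]. *)
Lemma psi_grad_subdifferential x lam y : 0 < lam ->
  is_minimizer (subproblem f df H psi x lam) y ->
  subdifferential psi y (psi_grad df H x lam y).
Proof.
move=> lam0 ym z; have [b bE] := subproblem_minimizer_fin ym.
rewrite bE; have := psi_proper.1 z.
case zE : (psi z) => [a| |]// _; last by rewrite leey.
rewrite -EFinD lee_fin psi_gradE; set h := z - y.
set C := 2^-1 * H x h h + lam / 2 * `|h| ^+ 2.
have C0 : 0 <= C by rewrite addr_ge0// mulr_ge0// divr_ge0// ltW.
set l := df x h + H x (y - x) h + lam * riesz (y - x) h.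
suff : forall e, 0 < e -> b - l <= a + e by move/ler_addgt0Pr; rewrite /l; lra.
move=> e e0; have Ce : 0 < C + e by rewrite ltr_wpDl.
have [t [t0 t1 tC]] : exists t : R, [/\ 0 < t, t <= 1 & t * C <= e].
  exists (e / (C + e)); split; first by rewrite divr_gt0.
    by rewrite ler_pdivrMr// mul1r lerDr.
  by rewrite mulrAC ler_pdivrMr// ler_pM2l// lerDl ltW.
have t01 : 0 <= t <= 1 by rewrite ltW.
have [r rE rl] := convex_efun_fin psi_proper psi_convex zE bE t01.
have := ym (t *: z + (1 - t) *: y); rewrite !subproblemE rE bE -!EFinD lee_fin.
have -> : t *: z + (1 - t) *: y - x = (y - x) + t *: h.
  by rewrite scalerBl scale1r /h scalerBr addrCA [LHS]addrAC.
rewrite (model_add _ _ _ (H_sym x) (y - x)) operatorZr dualZl !dualZr.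
rewrite normrZ exprMn (gtr0_norm t0).
move=> h1; rewrite -(ler_pM2l t0).
have : t * (t * C) <= t * e by rewrite ler_pM2l.
by rewrite /C /l; lra.
Qed.

(** A rejected parameter tells something only about the minimizers of its
    subproblem, so their existence has to be known. The subgradient provides
    an affine minorant of [psi], which the quadratic term dominates. *)
Lemma subproblem_minimizer_exists x lam (g : dual_space E) : 0 < lam ->
  (psi x < +oo)%E -> subdifferential psi x g ->
  exists y, is_minimizer (subproblem f df H psi x lam) y.
Proof.
move=> lam0 xfin gx; have [a aE] := proper_efun_fin psi_proper xfin.
pose Q y := model (f x) (df x) (H x) lam (y - x).
pose G := df x + g.
have lam80 : 0 < lam / 8 by rewrite divr_gt0.
apply: (@strongly_convex_minimizer R E Q psi (lam / 8) (f x + a - `|G| ^+ 2 / (2 * lam))) => //.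
- move=> y; apply: (@continuous_comp _ _ _ (fun y => y - x) (model (f x) (df x) (H x) lam)).
    by apply: cvgB; [exact: cvg_id|exact: cvg_cst].
  exact: model_continuous.
- move=> y z; rewrite /Q.
  have -> : 2^-1 *: y + (1 - 2^-1) *: z - x = 2^-1 *: (y - x) + (1 - 2^-1) *: (z - x).
    rewrite !scalerBr addrACA; congr (_ + _).
    by rewrite -opprD -scalerDl [2^-1 + _]addrC subrK scale1r.
  have -> : y - z = (y - x) - (z - x) by rewrite opprB addrA subrK.
  exact: (model_midpoint _ _ _ (H_sym x) (H_psd x)).
- move=> y; have := gx y; rewrite aE; have := psi_proper.1 y.
  case yE : (psi y) => [b| |]// _; last by move=> _; rewrite addey// leey.
  rewrite -!EFinD !lee_fin /Q /model; set w := y - x => h1.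
  have : - G w <= `|G| * `|w|.
    by have /ler_normlP[] := dual_le G w.
  have : 0 <= (lam * `|w| - `|G|) ^+ 2 / (2 * lam).
    by rewrite divr_ge0 ?sqr_ge0// mulr_ge0// ltW.
  have -> : (lam * `|w| - `|G|) ^+ 2 / (2 * lam) =
    lam / 2 * `|w| ^+ 2 - `|G| * `|w| + `|G| ^+ 2 / (2 * lam).
    by field; rewrite gt_eqF.
  have := H_psd x w; rewrite /G dualDl; lra.
Qed.

(** Monotonicity of the subdifferential of [psi] between [x] and [y] gives
    [lam |w|^2 + H x w w <= - (f'(x) + g)(w)]. *)
Lemma trial_step_bound x lam y (g : dual_space E) : 0 < lam ->
  (psi x < +oo)%E -> subdifferential psi x g ->
  is_minimizer (subproblem f df H psi x lam) y ->
  lam * `|y - x| <= `|df x + g|.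
Proof.
move=> lam0 xfin gx ym; have [a aE] := proper_efun_fin psi_proper xfin.
have [b bE] := subproblem_minimizer_fin ym.
have := gx y; have := psi_grad_subdifferential lam0 ym x.
rewrite aE bE -!EFinD !lee_fin -(opprB y x) dualNr psi_gradE riesz_norm.
set w := y - x.
have := H_psd x w.
have : - (df x + g) w <= `|df x + g| * `|w| by have /ler_normlP[] := dual_le (df x + g) w.
rewrite dualDl => h1 h2 h3 h4.
have h5 : lam * `|w| * `|w| <= `|df x + g| * `|w| by rewrite -mulrA -expr2; lra.
have [->|w0] := eqVneq w 0; first by rewrite normr0 mulr0.
by rewrite ler_pM2r ?normr_gt0// in h5.
Qed.

Lemma step_descent x lam y (a b : R) : 0 < lam ->
  is_minimizer (subproblem f df H psi x lam) y ->
  psi x = a%:E -> psi y = b%:E ->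
  F_grad df H x lam y (x - y) <= f x + a - (f y + b).
Proof.
move=> lam0 ym aE bE; have := psi_grad_subdifferential lam0 ym x.
rewrite aE bE -EFinD lee_fin => h; have := f_first_order y x.
by rewrite /F_grad dualDl; lra.
Qed.

(** With [|r| <= lam |w|], the expansion of [|r - lam R w|^2] gives the first
    test for [alpha = 1/2], and so for smaller [alpha]. With [|r| <= lam |w| / 2]
    the decrease is at least [lam |w|^2 / 2], which is the second test for
    [beta = 1/2]. *)
Lemma small_residual_acceptable alpha beta x lam y :
  0 < lam -> 0 < alpha <= 1 / 2 -> 0 < beta <= 1 / 2 -> (psi x < +oo)%E ->
  is_minimizer (subproblem f df H psi x lam) y ->
  `|df y - df x - H x (y - x)| <= lam / 2 * `|y - x| ->
  acceptable f df H psi alpha beta x lam y.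
Proof.
move=> lam0 /andP[al0 al1] /andP[be0 be1] xfin ym rl.
have [a aE] := proper_efun_fin psi_proper xfin.
have [b bE] := subproblem_minimizer_fin ym.
have D := step_descent lam0 ym aE bE.
have := dual_norm_sub_riesz (df y - df x - H x (y - x)) (y - x) lam.
have := dual_le (df y - df x - H x (y - x)) (y - x).
move: rl D; rewrite /acceptable F_gradE.
set r := df y - df x - _; set w := y - x => rl.
have -> : x - y = - w by rewrite opprB.
rewrite dualBl dualZl !dualNr riesz_norm => D /ler_normlP[_ rw] N.
have w0 : 0 <= `|w| by [].
have rw2 : r w <= lam / 2 * `|w| ^+ 2.
  by rewrite expr2 mulrA (le_trans rw)// ler_wpM2r.
have r2 : `|r| ^+ 2 <= lam ^+ 2 / 4 * `|w| ^+ 2.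
  have -> : lam ^+ 2 / 4 * `|w| ^+ 2 = (lam / 2 * `|w|) ^+ 2 by field.
  by rewrite ler_pXn2r ?nnegrE// mulr_ge0// divr_ge0// ltW.
split.
  rewrite -mulrA mulrC -mulrA ler_pdivrMl//.
  apply: (@le_trans _ _ (2^-1 * `|r - lam *: riesz w| ^+ 2)).
    by rewrite mulrC ler_wpM2r ?sqr_ge0//; lra.
  have := mulr_ge0 (ltW (mulr_gt0 lam0 lam0)) (sqr_ge0 `|w|).
  nra.
rewrite /composite aE bE -!EFinD lee_fin.
rewrite (le_trans _ D)//.
have : 0 <= lam * `|w| ^+ 2 by rewrite mulr_ge0 ?sqr_ge0// ltW.
nra.
Qed.

(** The form in which a rejection is used along a run: the trial step is short
    but has a large residual. *)
Lemma rejected_step alpha beta x lam (gx : dual_space E) :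
  0 < lam -> 0 < alpha <= 1 / 2 -> 0 < beta <= 1 / 2 -> (psi x < +oo)%E ->
  subdifferential psi x (gx - df x) ->
  (forall y, is_minimizer (subproblem f df H psi x lam) y ->
    ~ acceptable f df H psi alpha beta x lam y) ->
  exists y, lam * `|y - x| <= `|gx| /\
    lam / 2 * `|y - x| < `|df y - df x - H x (y - x)|.
Proof.
move=> lam0 al be xfin gP rej.
have [y ym] := subproblem_minimizer_exists lam0 xfin gP.
exists y; split.
  have := trial_step_bound lam0 xfin gP ym.
  by rewrite [df x + _]addrC subrK.
rewrite ltNge; apply/negP => rl; apply: (rej y ym).
exact: small_residual_acceptable.
Qed.

End subproblem_theory.

(** * Real sequences *)

Section sequences.
Context (R : realType).

Lemma geometric_step_cvg (V : completeNormedModType R) (x : nat -> V) (C q : R) :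
  0 <= q < 1 -> (forall k, `|x k.+1 - x k| <= C * q ^+ k) ->
  exists l : V, x @ \oo --> l.
Proof.
move=> /andP[q0 q1] xq; have q10 : 0 < 1 - q by rewrite subr_gt0.
have C0 : 0 <= C by have := xq 0; rewrite expr0 mulr1; apply: le_trans.
have tail n i : `|x n - x (n + i)%N| <= C / (1 - q) * q ^+ n * (1 - q ^+ i).
  elim: i => [|i IH]; first by rewrite addn0 subrr normr0 expr0 subrr mulr0.
  have -> : x n - x (n + i.+1)%N = (x n - x (n + i)%N) - (x (n + i).+1 - x (n + i)%N).
    by rewrite addnS opprB addrA subrK.
  rewrite (le_trans (ler_normB _ _))// (le_trans (lerD IH (xq _)))//.
  rewrite le_eqVlt; apply/orP; left; apply/eqP.
  by rewrite exprD exprS; field; rewrite gt_eqF.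
apply: sequence_cauchy_cvg => e e0.
have q_cvg : (fun n => C / (1 - q) * q ^+ n) @ \oo --> 0.
  rewrite -[X in _ --> X](mulr0 (C / (1 - q))); apply: cvgM; first exact: cvg_cst.
  by apply: cvg_expr; rewrite ger0_norm.
have [N _ NP] : \forall n \near \oo, `|C / (1 - q) * q ^+ n| < e.
  by move/cvgr0Pnorm_lt : q_cvg; apply.
exists N => n Nn; rewrite -(subnKC Nn) (le_lt_trans (tail _ _))//.
have CN : 0 <= C / (1 - q) * q ^+ N by rewrite mulr_ge0 ?exprn_ge0// divr_ge0// ltW.
rewrite (le_lt_trans _ (NP N (leqnn N)))//= ger0_norm//.
by rewrite ler_piMr// gerBl exprn_ge0.
Qed.

(** With [M = s 0 + 4 C] and [p = max q 1/2], a step adds at most [M p^k / 4]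
    from the contraction and [M p^k / 4] from the perturbation, and
    [M / 2 <= M p]. *)
Lemma geometric_majorant (s : nat -> R) (q C : R) : 0 <= q < 1 -> 0 <= C ->
  (forall k, 0 <= s k) ->
  (forall k, s k.+1 <= 4^-1 * s k + C * q ^+ k) ->
  exists M p, [/\ 0 <= M, 0 <= p < 1 & forall k, s k <= M * p ^+ k].
Proof.
move=> /andP[q0 q1] C0 s0 sS.
exists (s 0 + 4 * C), (Num.max q 2^-1).
set p := Num.max _ _; have M0 : 0 <= s 0 + 4 * C by rewrite addr_ge0 ?mulr_ge0.
have p2 : 2^-1 <= p by rewrite le_max lexx orbT.
have p0 : 0 <= p by rewrite (le_trans _ p2).
split => //; first by rewrite p0/= gt_max q1; lra.
elim=> [|k IH]; first by rewrite expr0 mulr1 lerDl mulr_ge0.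
have qp : q ^+ k <= p ^+ k by rewrite lerXn2r ?nnegrE// le_max lexx.
have pk : 0 <= p ^+ k by rewrite exprn_ge0.
rewrite (le_trans (sS k))// exprS.
have h1 : C * q ^+ k <= C * p ^+ k by rewrite ler_wpM2l.
have h2 : 0 <= s 0 * p ^+ k by rewrite mulr_ge0.
have h3 : (s 0 + 4 * C) * p ^+ k * 2^-1 <= (s 0 + 4 * C) * p ^+ k * p.
  by rewrite ler_wpM2l// mulr_ge0.
by have := mulr_ge0 C0 pk; lra.
Qed.

Lemma halving_cvg0 (lam : nat -> R) : (forall k, 0 <= lam k) ->
  (forall e, 0 < e -> \forall k \near \oo, lam k.+1 <= lam k / 2 + e) ->
  lam @ \oo --> 0.
Proof.
move=> lam0 H; apply/cvgr0Pnorm_lt => e e0.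
have e40 : 0 < e / 4 by rewrite divr_gt0.
have [K _ KP] := H _ e40.
have bnd i : lam (i + K)%N <= e / 2 + lam K * 2^-1 ^+ i.
  elim: i => [|i IH]; first by rewrite add0n expr0 mulr1 lerDr divr_ge0// ltW.
  have /= := KP (i + K)%N (leq_addl _ _); rewrite addSn exprS.
  by move: IH; set z := 2^-1 ^+ i; lra.
have h_cvg : (fun n => lam K * 2^-1 ^+ n) @ \oo --> 0.
  rewrite -[X in _ --> X](mulr0 (lam K)); apply: cvgM; first exact: cvg_cst.
  by apply: cvg_expr; rewrite ger0_norm//; lra.
have e20 : 0 < e / 2 by rewrite divr_gt0.
have [N _ NP] : \forall n \near \oo, `|lam K * 2^-1 ^+ n| < e / 2.
  by move/cvgr0Pnorm_lt : h_cvg; apply.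
exists (N + K)%N => // n /= Nn; rewrite ger0_norm//.
have nK : (K <= n)%N by rewrite (leq_trans _ Nn)// leq_addl.
rewrite -(subnK nK) (le_lt_trans (bnd _))//.
have /= := NP (n - K)%N; rewrite leq_subRL// addnC => /(_ Nn) /ltr_normlP[_].
by move: (lam K * _) => z; lra.
Qed.

Lemma superlinear_of_sqr (a th : nat -> R) : (forall k, 0 <= a k) ->
  (forall k, 0 <= th k) ->
  th @ \oo --> 0 -> (forall k, a k.+1 ^+ 2 <= th k * a k ^+ 2) -> superlinear a.
Proof.
move=> a0 th_ge0 th0 ath; exists (fun k => Num.sqrt (th k)); split.
  rewrite -[X in _ --> X]sqrtr0; apply: continuous_cvg => //.
  exact: sqrt_continuous.
apply: nearW => k; rewrite -[leLHS](ger0_norm (a0 _)) -sqrtr_sqr.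
rewrite -[X in _ * X](ger0_norm (a0 _)) -sqrtr_sqr -sqrtrM//.
exact: ler_wsqrtr.
Qed.

(** Once the steps shrink by a factor 4, the distance from [x k.+1] to the limit
    is at most twice the next step, hence at most [2 eps_k |x k.+1 - x k|], and
    the step itself is at most the sum of the two distances to the limit. *)
Lemma superlinear_of_steps (V : normedModType R) (x : nat -> V) (l : V) :
  x @ \oo --> l -> superlinear (fun k => `|x k.+1 - x k|) ->
  superlinear (fun k => `|x k - l|).
Proof.
move=> xl [eps [eps0 [K1 _ epsP]]].
exists (fun k => 4 * `|eps k|); split.
  rewrite -[X in _ --> X](mulr0 4); apply: cvgM; first exact: cvg_cst.
  exact/norm_cvg0P.
have [K2 _ K2P] : \forall k \near \oo, `|eps k| < 4^-1.
  by move/cvgr0Pnorm_lt : eps0; apply; lra.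
exists (maxn K1 K2) => // k /=; rewrite geq_max => /andP[k1 k2].
set s := fun k => `|x k.+1 - x k| in epsP.
have sS i : s (k + i).+1 <= 4^-1 * s (k + i)%N.
  have /= h := epsP (k + i)%N (leq_trans k1 (leq_addr _ _)).
  have /= /ltr_normlP[_ h2] := K2P (k + i)%N (leq_trans k2 (leq_addr _ _)).
  by rewrite (le_trans h)// ler_wpM2r// ltW.
have tail i : `|x k.+1 - x (k.+1 + i)%N| <= 2 * s k.+1 - 2 * s (k.+1 + i)%N.
  elim: i => [|i IH]; first by rewrite addn0 !subrr normr0.
  have -> : x k.+1 - x (k.+1 + i.+1)%N =
      (x k.+1 - x (k.+1 + i)%N) - (x (k.+1 + i).+1 - x (k.+1 + i)%N).
    by rewrite addnS opprB addrA subrK.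
  rewrite (le_trans (ler_normB _ _))//.
  have := sS i.+1; rewrite addnS -addSn addnS -/(s _).
  rewrite -/(s (k.+1 + i)%N).
  have : 0 <= s (k.+1 + i)%N by exact: normr_ge0.
  by lra.
have lim : `|x k.+1 - l| <= 2 * s k.+1.
  have L : (`|x k.+1 - x (n + k.+1)%N|) @[n --> \oo] --> `|x k.+1 - l|.
    apply: cvg_norm; apply: cvgB; first exact: cvg_cst.
    by rewrite (cvg_shiftn k.+1).
  apply: (cvgr_to_le L); apply: nearW => n; rewrite addnC.
  rewrite (le_trans (tail n))//.
  by rewrite gerBl mulr_ge0// normr_ge0.
have := epsP k k1; rewrite /= => h.
have /= h1 := K2P k k2; have h2 := ler_norm (eps k).
have tri : s k <= `|x k.+1 - l| + `|x k - l|.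
  rewrite /s; have -> : x k.+1 - x k = (x k.+1 - l) - (x k - l).
    by rewrite opprB addrA subrK.
  exact: ler_normB.
move: lim h tri h1 h2; set u := `|x k.+1 - l|; set w := `|x k - l|.
have b0 : 0 <= s k by exact: normr_ge0.
have u0 : 0 <= u by exact: normr_ge0.
rewrite -/(s k.+1) => H1 H2 H3 H4 H5.
have H6 : s k.+1 <= `|eps k| * s k by rewrite (le_trans H2)// ler_wpM2r.
have H7 : `|eps k| * s k <= `|eps k| * (u + w) by rewrite ler_wpM2l.
have H8 : `|eps k| * u <= 4^-1 * u by rewrite ler_wpM2r// ltW.
by move: H7; rewrite mulrDr; lra.
Qed.

End sequences.

(** * Convergence rates from the acceptance tests *)

(** In this section [lam], [D], [N] and [s] stand for the regularization
    parameters, the objective gaps, the gradient norms and the step lengths of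
    a run. [D_le] is the Polyak-Lojasiewicz inequality, [N_decrease] and [N_le]
    come from the first acceptance test together with convexity and with the
    Cauchy-Schwarz inequality, and [s_decrease] is the second test. *)

Section rates.
Context (R : realType).
Variables (lam D N s : nat -> R) (alpha beta mu : R).
Hypotheses (alpha0 : 0 < alpha) (beta0 : 0 < beta) (mu0 : 0 < mu).
Hypothesis lam0 : forall k, 0 < lam k.
Hypothesis lam_half : forall k, lam k / 2 <= lam k.+1.
Hypothesis D0 : forall k, 0 <= D k.
Hypothesis N0 : forall k, 0 <= N k.
Hypothesis s0 : forall k, 0 <= s k.
Hypothesis D_le : forall k, 2 * mu * D k <= N k ^+ 2.
Hypothesis N_decrease : forall k, alpha * N k.+1 ^+ 2 <= lam k * (D k - D k.+1).
Hypothesis s_decrease : forall k, beta * lam k * s k ^+ 2 <= D k - D k.+1.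
Hypothesis N_le : forall k, alpha * N k.+1 <= lam k * s k.

Lemma gap_contraction k :
  (2 * mu * alpha + lam k) * D k.+1 <= lam k * D k.
Proof.
have : alpha * (2 * mu * D k.+1) <= alpha * N k.+1 ^+ 2 by rewrite ler_pM2l.
by have := N_decrease k; lra.
Qed.

Lemma gap_le k : D k.+1 <= lam k / (2 * mu * alpha) * D k.
Proof.
have ma : 0 < 2 * mu * alpha by rewrite !mulr_gt0.
rewrite mulrAC ler_pdivlMr//; have := gap_contraction k.
by have := mulr_ge0 (ltW (lam0 k)) (D0 k.+1); lra.
Qed.

Lemma gradient_sqr_le k : N k.+1 ^+ 2 <= lam k / (2 * mu * alpha) * N k ^+ 2.
Proof.
have ma : 0 < 2 * mu * alpha by rewrite !mulr_gt0.
rewrite mulrAC ler_pdivlMr//.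
have h1 : lam k * (2 * mu * D k) <= lam k * N k ^+ 2 by rewrite ler_pM2l.
have h2 : mu * (alpha * N k.+1 ^+ 2) <= mu * (lam k * (D k - D k.+1)).
  by rewrite ler_pM2l.
have h3 : 0 <= mu * (lam k * D k.+1) by rewrite !mulr_ge0// ltW.
by lra.
Qed.

Lemma step_sqr_le_gap k : beta * lam k * s k.+1 ^+ 2 <= 2 * D k.+1.
Proof.
have h1 : beta * (lam k / 2) * s k.+1 ^+ 2 <= beta * lam k.+1 * s k.+1 ^+ 2.
  by rewrite ler_wpM2r ?sqr_ge0// ler_pM2l.
by have := s_decrease k.+1; have := D0 k.+2; lra.
Qed.

(** The gap after the step is controlled by the gradient there, and that by the
    step through [N_le]; the factor [lam k ^+ 2] so gained outweighs the
    [lam k] lost in passing from the gap to the next step. *)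
Lemma step_sqr_le k :
  s k.+1 ^+ 2 <= lam k / (alpha ^+ 2 * mu * beta) * s k ^+ 2.
Proof.
have ma : 0 < alpha ^+ 2 * mu * beta by rewrite !mulr_gt0 ?exprn_gt0.
rewrite mulrAC ler_pdivlMr//.
have h1 : alpha ^+ 2 * N k.+1 ^+ 2 <= lam k ^+ 2 * s k ^+ 2.
  rewrite -!exprMn ler_pXn2r ?nnegrE ?mulr_ge0//; exact: ltW.
have h2 : alpha ^+ 2 * mu * (beta * lam k * s k.+1 ^+ 2) <= alpha ^+ 2 * mu * (2 * D k.+1).
  by rewrite ler_pM2l ?step_sqr_le_gap// mulr_gt0 ?exprn_gt0.
have h3 : alpha ^+ 2 * (2 * mu * D k.+1) <= alpha ^+ 2 * N k.+1 ^+ 2.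
  by rewrite ler_pM2l ?exprn_gt0.
rewrite -(ler_pM2l (lam0 k)); lra.
Qed.

(** Bounding the steps by the gaps alone would lose a factor [1 / lam k],
    which is unbounded when [lam] tends to 0. So the steps contract by
    [step_sqr_le] when [lam k] is small, and only otherwise are they compared
    with the gaps. *)
Lemma steps_geometric (M : R) : (forall k, lam k <= M) ->
  exists C q, 0 <= q < 1 /\ forall k, s k <= C * q ^+ k.
Proof.
move=> lamM; have M0 : 0 < M by exact: lt_le_trans (lam0 0) (lamM 0).
have ma : 0 < 2 * mu * alpha by rewrite !mulr_gt0.
pose q := M / (2 * mu * alpha + M).
have maM : 0 < 2 * mu * alpha + M by rewrite addr_gt0.
have q0 : 0 <= q by rewrite divr_ge0// ltW.
have q1 : q < 1 by rewrite ltr_pdivrMr// mul1r ltrDr.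
have Dq k : D k.+1 <= q * D k.
  rewrite /q mulrAC ler_pdivlMr// mulrC.
  have h1 := gap_contraction k.
  have h2 : 0 <= (M - lam k) * (D k - D k.+1).
    rewrite mulr_ge0 ?subr_ge0//; have := s_decrease k.
    have : 0 <= beta * lam k * s k ^+ 2 by rewrite !mulr_ge0// ltW.
    by lra.
  by lra.
have Dqk k : D k <= D 0 * q ^+ k.
  elim: k => [|k IH]; first by rewrite expr0 mulr1.
  by rewrite (le_trans (Dq k))// exprS mulrCA ler_wpM2l.
pose K := (alpha ^+ 2 * mu * beta)^-1.
have K0 : 0 < K by rewrite invr_gt0 !mulr_gt0 ?exprn_gt0.
pose C := 8 * K * D 0 / beta.
have C0 : 0 <= C by rewrite divr_ge0 ?mulr_ge0 ?(ltW K0) ?(ltW beta0).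
have key k : s k.+1 ^+ 2 <= 4^-1 * s k ^+ 2 + C * q ^+ k.
  have [small|large] := lerP (lam k * K) 4^-1.
    rewrite (le_trans (step_sqr_le k))// -[X in X <= _]addr0 lerD//.
      by rewrite ler_wpM2r ?sqr_ge0.
    by rewrite mulr_ge0 ?exprn_ge0.
  have h1 := step_sqr_le_gap k.
  have h2 : D k.+1 <= D 0 * q ^+ k.
    by rewrite (le_trans (Dq k))// (le_trans _ (Dqk k))// ler_piMl// ltW.
  rewrite -[X in X <= _]add0r lerD ?mulr_ge0 ?sqr_ge0 ?invr_ge0//.
  have -> : C * q ^+ k = 8 * K * (D 0 * q ^+ k) / beta by rewrite /C; field; rewrite gt_eqF.
  rewrite ler_pdivlMr// [_ * beta]mulrC.
  have h3 : 8 * K * D k.+1 <= 8 * K * (D 0 * q ^+ k) by rewrite ler_wpM2l// mulr_ge0// ltW.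
  apply: le_trans h3.
  have h4 : 4 * K * (beta * lam k * s k.+1 ^+ 2) <= 4 * K * (2 * D k.+1).
    by rewrite ler_wpM2l// mulr_ge0// ltW.
  have h5 : 4^-1 * (beta * s k.+1 ^+ 2) <= lam k * K * (beta * s k.+1 ^+ 2).
    by rewrite ler_wpM2r ?mulr_ge0 ?sqr_ge0// ltW.
  by lra.
have q01 : 0 <= q < 1 by rewrite q0.
have [A [p [A0 /andP[p0 p1] sp]]] :=
  geometric_majorant q01 C0 (fun k => sqr_ge0 (s k)) key.
exists (Num.sqrt A), (Num.sqrt p); split.
  by rewrite sqrtr_ge0/= -[ltRHS]sqrtr1 ltr_sqrt.
move=> k; rewrite -[s k]ger0_norm// -sqrtr_sqr (le_trans (ler_wsqrtr (sp k)))//.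
rewrite sqrtrM//.
have -> : Num.sqrt (p ^+ k) = Num.sqrt p ^+ k; last by [].
elim: k => [|k IH]; first by rewrite !expr0 sqrtr1.
by rewrite !exprS sqrtrM// IH.
Qed.

End rates.

(** * Superlinear convergence *)

Lemma dist0_le (R : realType) (E : normedModType R) (G : set (dual_space E)) g :
  G g -> (dist0 G ^+ 2 <= (`|g| ^+ 2)%:E)%E.
Proof.
move=> Gg; have h1 : (dist0 G <= `|g|%:E)%E by apply: ereal_inf_lbound; exists g.
have h0 : (0 <= dist0 G)%E.
  by apply: le_ereal_inf_tmp => _ [h _ <-]; rewrite lee_fin.
move: h0 h1; case: (dist0 G) => [r| |]//; rewrite !lee_fin => r0 rg.
by rewrite expr2 ler_pM.
Qed.

Theorem corollary6p8 (R : realType) (E : hilbertType R)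
    (f : E -> R) (df : E -> dual_space E)
    (d2f : E -> bounded_operator E (dual_space E)) (psi : E -> \bar R)
    (Fstar : R)
    (f_diff : forall x, is_diff x f (df x))
    (df_lipschitz : lipschitz df)
    (df_diff : forall x, is_diff x df (d2f x))
    (d2f_continuous : continuous d2f)
    (f_convex : convex_function [set: convex_lmodType E] f)
    (psi_proper : proper_efun psi)
    (psi_convex : convex_efun psi)
    (psi_lsc : lower_semicontinuous psi)
    (Fstar_le : forall x, (Fstar%:E <= composite f psi x)%E)
    (solution : [set x | composite f psi x = Fstar%:E] !=set0)
    (L : R) (L_ge0 : 0 <= L)
    (linearization_error : forall x y,
      `|df y - df x - d2f x (y - x)| <= L * `|x - y|)
    (mu : R) (mu_gt0 : 0 < mu)
    (PL : forall x, (composite f psi x < +oo)%E ->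
      (((2 * mu)^-1)%:E * dist0 (composite_subdifferential df psi x) ^+ 2
         >= composite f psi x - Fstar%:E)%E)
    (m alpha beta : R) (m_ge1 : 1 <= m)
    (alpha_gt0 : 0 < alpha) (alpha_le : alpha <= 1 / 2)
    (beta_gt0 : 0 < beta) (beta_le : beta <= (m - 1) / (2 * m))
    (x0 : E) (x0_dom : (composite f psi x0 < +oo)%E)
    (psi'0 : dual_space E) (psi'0_sub : subdifferential psi x0 psi'0)
    (Lam0 : R) (Lam0_gt0 : 0 < Lam0)
    (x : nat -> E) (gF : nat -> dual_space E) (lam Lam : R^nat) (j : nat -> nat)
    (run : leap_ssn_run f df d2f psi alpha beta x0 psi'0 Lam0 x gF lam Lam j) :
  exists xstar : E,
    [/\ x @ \oo --> xstar,
        is_minimizer (composite f psi) xstar,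
        superlinear (fun k => `|x k - xstar|),
        superlinear (fun k => fine (composite f psi (x k) - Fstar%:E)%E) &
        superlinear (fun k => `|gF k|)].
Proof.
case: run => run_x0 run_gF0 run_Lam0 run_lam run_x run_accept run_reject run_Lam run_gF.
have H_sym z u v : d2f z u v = d2f z v u by exact: (hessian_symmetric f_diff u v (df_diff z)).
have H_psd z u : 0 <= d2f z u u by exact: (hessian_psd f_diff f_convex u (df_diff z)).
have f_grad y z : f y + df y (z - y) <= f z by exact: convex_first_order.
have al : 0 < alpha <= 1 / 2 by rewrite alpha_gt0.
(* [(m - 1) / (2 m)] is below 1/2. *)
have be : 0 < beta <= 1 / 2.
  rewrite beta_gt0 (le_trans beta_le)// ler_pdivrMr ?mulr_gt0 ?(lt_le_trans _ m_ge1)//.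
  lra.
have Lam_gt0 k : 0 < Lam k.
  elim: k => [|k IH]; first by rewrite run_Lam0.
  by rewrite run_Lam run_lam divr_gt0// mulr_gt0// exprn_gt0.
have lam_gt0 k : 0 < lam k by rewrite run_lam mulr_gt0// exprn_gt0.
have psi_fin k : exists a : R, psi (x k) = a%:E.
  case: k => [|k]; last exact: (subproblem_minimizer_fin psi_proper (run_x k)).
  apply: proper_efun_fin => //; rewrite run_x0 ltey; apply/eqP => h.
  by move: x0_dom; rewrite /composite h addey.
have [a aE] := choice psi_fin.
have psi_lt k : (psi (x k) < +oo)%E by rewrite aE ltry.
have sub k : subdifferential psi (x k) (gF k - df (x k)).
  case: k => [|k]; first by rewrite run_gF0 run_x0 [df x0 + _]addrC addrK.
  rewrite run_gF /F_grad [df _ + _]addrC addrK.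
  exact: (psi_grad_subdifferential H_sym H_psd psi_proper psi_convex).
pose D k := f (x k) + a k - Fstar.
pose N k := `|gF k|; pose s k := `|x k.+1 - x k|.
have gapE k : (composite f psi (x k) - Fstar%:E)%E = (D k)%:E.
  by rewrite /composite aE.
have D_ge0 k : 0 <= D k.
  by have := Fstar_le (x k); rewrite /composite aE -EFinD lee_fin subr_ge0.
have N_ge0 k : 0 <= N k by exact: normr_ge0.
have s_ge0 k : 0 <= s k by exact: normr_ge0.
have D_le k : 2 * mu * D k <= N k ^+ 2.
  have mu2 : 0 < 2 * mu by rewrite mulr_gt0.
  have Gg : composite_subdifferential df psi (x k) (gF k).
    by exists (gF k - df (x k)) => //; rewrite addrC subrK.
  have dom : (composite f psi (x k) < +oo)%E by rewrite /composite aE -EFinD ltry.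
  have := PL _ dom; rewrite gapE => h.
  have h2 : ((D k)%:E <= ((2 * mu)^-1)%:E * (N k ^+ 2)%:E)%E.
    by rewrite (le_trans h)// lee_wpmul2l ?dist0_le// lee_fin invr_ge0 ltW.
  by rewrite mulrC -ler_pdivlMr// mulrC -lee_fin EFinM.
have descent k : gF k.+1 (x k - x k.+1) <= D k - D k.+1.
  have := step_descent H_sym H_psd f_grad psi_proper psi_convex (lam_gt0 k) (run_x k)
    (aE k) (aE k.+1).
  by rewrite run_gF /D; lra.
have accept1 k : alpha * N k.+1 ^+ 2 <= lam k * gF k.+1 (x k - x k.+1).
  have [h _] := run_accept k; rewrite -run_gF in h.
  by rewrite -ler_pdivrMl// mulrA [_^-1 * _]mulrC.
have N_decrease k : alpha * N k.+1 ^+ 2 <= lam k * (D k - D k.+1).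
  by rewrite (le_trans (accept1 k))// ler_pM2l.
have s_decrease k : beta * lam k * s k ^+ 2 <= D k - D k.+1.
  have [_ h] := run_accept k; move: h.
  by rewrite /composite !aE -!EFinD lee_fin -/(s k) /D; lra.
have N_le k : alpha * N k.+1 <= lam k * s k.
  have h : gF k.+1 (x k - x k.+1) <= N k.+1 * s k.
    have /ler_normlP[_ h] := dual_le (gF k.+1) (x k - x k.+1).
    by rewrite /s distrC.
  have [N0|N0] := eqVneq (N k.+1) 0; first by rewrite N0 mulr0 mulr_ge0// ltW.
  have Np : 0 < N k.+1 by rewrite lt_neqAle eq_sym N0 N_ge0.
  rewrite -(ler_pM2r Np) -mulrA -expr2 (le_trans (accept1 k))//.
  by rewrite -mulrA ler_pM2l// [s k * _]mulrC.
(* [lam k.+1] is [Lam k.+1 = lam k / 2] multiplied by a power of 2. *)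
have lam_half k : lam k / 2 <= lam k.+1.
  by rewrite [lam k.+1]run_lam -run_Lam ler_peMl ?(ltW (Lam_gt0 _))// exprn_ege1// ler1n.
(* When the backtracking at [x k] does not stop at once, the last rejected
   parameter is [lam k / 2]. *)
pose rejected k := exists y, lam k / 2 * `|y - x k| <= N k /\
  lam k / 4 * `|y - x k| < `|df y - df (x k) - d2f (x k) (y - x k)|.
have reject k : lam k = Lam k \/ rejected k.
  have := run_lam k; have := run_reject k.
  case: (j k) => [|i] rej lamE; [left|right]; first by rewrite lamE expr0 mul1r.
  have l2 : 2 ^+ i * Lam k = lam k / 2 by rewrite lamE exprS; field.
  have := rej i (ltnSn i); rewrite l2 => rej'.
  have l20 : 0 < lam k / 2 by rewrite divr_gt0.
  have [y [h1 h2]] := rejected_step H_sym H_psd f_grad psi_proper psi_convex psi_lsc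
    l20 al be (psi_lt k) (sub k) rej'.
  by exists y; split=> //; have -> : lam k / 4 = lam k / 2 / 2 by field.
have lam_le k : lam k <= Num.max Lam0 (4 * L).
  have rej_le i : rejected i -> lam i <= Num.max Lam0 (4 * L).
    move=> [y [_ h]]; rewrite le_max; apply/orP; right.
    have := lt_le_trans h (linearization_error (x i) y).
    rewrite [`|x i - y|]distrC.
    have [->|w0] := eqVneq (`|y - x i|) 0; first by rewrite !mulr0 ltxx.
    rewrite ltr_pM2r; last by rewrite lt_neqAle eq_sym w0 normr_ge0.
    by move=> h'; apply/ltW; lra.
  elim: k => [|k IH].
    by have [->|/rej_le//] := reject 0; rewrite run_Lam0 le_max lexx.
  have [->|/rej_le//] := reject k.+1.
  by rewrite run_Lam (le_trans _ IH)//; have := lam_gt0 k; lra.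
have [C [q [q01 sq]]] := steps_geometric alpha_gt0 beta_gt0 mu_gt0 lam_gt0 lam_half
  D_ge0 N_ge0 s_ge0 D_le N_decrease s_decrease N_le lam_le.
have [xs xcvg] := geometric_step_cvg q01 sq.
have s_cvg0 : s @ \oo --> 0.
  rewrite -[X in _ --> X](normr0 E); apply: cvg_norm; rewrite -[X in _ --> X](subrr xs).
  by apply: cvgB => //; rewrite cvg_shiftS.
have N_cvg0 : N @ \oo --> 0.
  rewrite -cvg_shiftS; pose M := Num.max Lam0 (4 * L) / alpha.
  apply: (@squeeze_cvgr _ _ _ _ (cst 0) (fun k => M * s k)).
  - apply: nearW => k; rewrite N_ge0 /M mulrAC ler_pdivlMr// mulrC.
    by rewrite (le_trans (N_le k))// ler_wpM2r.
  - exact: cvg_cst.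
  - by rewrite -[X in _ --> X](mulr0 M); apply: cvgM => //; exact: cvg_cst.
have lam_cvg0 : lam @ \oo --> 0.
  apply: halving_cvg0 => [k|e e0]; first exact: ltW.
  have e40 : 0 < e / 4 by rewrite divr_gt0.
  have [d d0 dP] := local_linearization df_diff (d2f_continuous xs) e40.
  have d20 : 0 < d / 2 by rewrite divr_gt0.
  have ed0 : 0 < e / 2 * (d / 2) by rewrite mulr_gt0// divr_gt0.
  near=> k.
  have xk : `|x k.+1 - xs| < d / 2.
    by near: k; move: xcvg; rewrite -cvg_shiftS => /cvgrPdistC_lt; apply.
  have Nk : N k.+1 < e / 2 * (d / 2).
    near: k; move: N_cvg0; rewrite -cvg_shiftS => /cvgr0Pnorm_lt/(_ _ ed0).
    by apply: filterS => k /=; rewrite ger0_norm.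
  have lk := ltW (lam_gt0 k).
  have [->|[y [h1 h2]]] := reject k.+1; first by rewrite run_Lam lerDl ltW.
  suff : lam k.+1 <= e by move=> h; rewrite (le_trans h)// lerDr divr_ge0.
  rewrite leNgt; apply/negP => el.
  have yk : `|y - x k.+1| < d / 2.
    have e20 : 0 < e / 2 by rewrite divr_gt0.
    rewrite -(ltr_pM2l e20) (le_lt_trans _ Nk)// (le_trans _ h1)//.
    by rewrite ler_wpM2r//; lra.
  have ys : `|y - xs| < d.
    have -> : y - xs = (y - x k.+1) + (x k.+1 - xs) by rewrite addrA subrK.
    by rewrite (le_lt_trans (ler_normD _ _))//; lra.
  have xd : `|x k.+1 - xs| < d by lra.
  have := lt_le_trans h2 (dP _ _ xd ys).
  by rewrite ltNge ler_wpM2r//; lra.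
have superscale c : 0 < c -> (fun k => lam k / c) @ \oo --> 0.
  by move=> c0; rewrite -[X in _ --> X](mul0r c^-1); apply: cvgM => //; exact: cvg_cst.
have ma0 : 0 < 2 * mu * alpha by rewrite !mulr_gt0.
have mab0 : 0 < alpha ^+ 2 * mu * beta by rewrite !mulr_gt0 ?exprn_gt0.
have D_super : superlinear D.
  exists (fun k => lam k / (2 * mu * alpha)); split; first exact: superscale.
  by apply: nearW => k; exact: (gap_le alpha_gt0 mu_gt0 lam_gt0 D_ge0 D_le N_decrease).
have D_cvg0 : D @ \oo --> 0.
  rewrite -cvg_shiftS.
  apply: (@squeeze_cvgr _ _ _ _ (cst 0) (fun k => (2 * mu)^-1 * N k.+1 ^+ 2)).
  - apply: nearW => k; rewrite D_ge0/= ler_pdivlMl ?mulr_gt0//.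
  - exact: cvg_cst.
  - rewrite -[X in _ --> X](mulr0 (2 * mu)^-1); apply: cvgM; first exact: cvg_cst.
    have N1 : (fun k => N k.+1) @ \oo --> 0 by rewrite cvg_shiftS.
    rewrite -[X in _ --> X](mulr0 0); under eq_fun do rewrite expr2.
    exact: cvgM.
exists xs; split => //.
- move=> z; apply: le_trans (Fstar_le z).
  apply: (@lower_semicontinuous_add_limit _ _ f psi x xs (fun k => Fstar + D k)) => //.
  + exact: (differentiable_continuous (@ex_diff _ _ _ _ _ _ _ (f_diff xs))).
  + by rewrite -[X in _ --> X]addr0; apply: cvgD => //; exact: cvg_cst.
  + by move=> k; rewrite aE -EFinD lee_fin /D; lra.
- apply: superlinear_of_steps => //.
  apply: (@superlinear_of_sqr _ s (fun k => lam k / (alpha ^+ 2 * mu * beta))) => //.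
  + by move=> k; rewrite divr_ge0// ltW.
  + exact: superscale.
  + exact: (step_sqr_le alpha_gt0 beta_gt0 mu_gt0 lam_gt0 lam_half
      D_ge0 N_ge0 s_ge0 D_le s_decrease N_le).
- have -> : (fun k => fine (composite f psi (x k) - Fstar%:E)%E) = D.
    by apply/funext => k; rewrite gapE.
  exact: D_super.
- apply: (@superlinear_of_sqr _ N (fun k => lam k / (2 * mu * alpha))) => //.
  + by move=> k; rewrite divr_ge0// ltW.
  + exact: superscale.
  + exact: (gradient_sqr_le alpha_gt0 mu_gt0 lam_gt0 D_ge0 D_le N_decrease).
Unshelve. all: by end_near. Qed.
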